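(* Let $k\geq 1$, $n\geq 0$ and $0\leq p\leq n$ be integers. Then the number $c_p(M_{n,k})$ of induced subgraphs of the Munarini graph $M_{n,k}$ isomorphic to the hypercube $Q_p$ is $$c_p(M_{n,k})=\sum_{d=p}^{n}\sum_{j=0}^{d}\binom{d}{p}\binom{d}{j}\binom{n-j}{d}(k-1)^{d-j}.$$
   Context: For integers $k\geq 1$, $n\geq 0$, a $k$-generalized Pell string of length $n$ is a word of length $n$ over the alphabet $\{0,1,\ldots,k\}$ in which every maximal run of the character $k$ has even length (equivalently, a concatenation of letters from $\{0,1,\ldots,k-1,kk\}$). Let $\mathcal{F}_{n,k}$ be the set of these strings (for $n=0$ it contains only the empty string). The Munarini graph $M_{n,k}$ is the simple graph with vertex set $\mathcal{F}_{n,k}$ in which two vertices are adjacent if one of them can be obtained from the other either by replacing one occurrence of $0$ with some $i\in\{1,\ldots,k-1\}$, or by replacing one substring $00$ (two consecutive positions) with $kk$ (both replacements may be read in either direction, and both strings must be in $\mathcal{F}_{n,k}$). $Q_p$ is the $p$-dimensional hypercube ($Q_0=K_1$). Conventions: $0^0=1$, and $\binom{a}{b}=0$ if $b>a\geq 0$. *)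

(* Defs.v *)
From HB Require Import structures.
From mathcomp Require Import all_boot.

Set Implicit Arguments.
Unset Strict Implicit.
Unset Printing Implicit Defensive.

Record sgraph := SGraph {
  vertex :> finType;
  adj : rel vertex;
  adj_sym : symmetric adj;
  adj_irr : irreflexive adj }.

Definition graph_iso (G H : sgraph) : bool :=
  [exists f : {ffun G -> H},
    [&& injectiveb f, [forall y, y \in codom f]
      & [forall x, forall y, adj (f x) (f y) == adj x y]]].

Lemma graph_isoP (G H : sgraph) :
  reflect (exists2 f : G -> H, bijective f & {mono f : x y / adj x y})
          (graph_iso G H).
Proof.
apply: (iffP existsP) => [[f /and3P[/injectiveP fI /forallP fS /forallP fE]]|].
  exists f => [|x y]; last by have /forallP/(_ y)/eqP := fE x.
  by apply: inj_card_bij => //; rewrite -(card_codom fI); apply: subset_leq_card; apply/subsetP => y _.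
case=> f [g fK gK] fE; exists [ffun x => f x]; apply/and3P; split.
- by apply/injectiveP => x y; rewrite !ffunE => /(can_inj fK).
- by apply/forallP => y; apply/codomP; exists (g y); rewrite ffunE gK.
- by apply/forallP => x; apply/forallP => y; rewrite !ffunE fE.
Qed.

Section Induced.
Variables (G : sgraph) (S : {set G}).

Definition induced_adj : rel {x : G | x \in S} :=
  fun x y => adj (val x) (val y).

Lemma induced_sym : symmetric induced_adj.
Proof. by move=> x y; apply: adj_sym. Qed.

Lemma induced_irr : irreflexive induced_adj.
Proof. by move=> x; apply: adj_irr. Qed.

Definition induced : sgraph := SGraph induced_sym induced_irr.
End Induced.

(* Induced subgraphs of G correspond to subsets of its vertex set. *)
Definition num_induced (G H : sgraph) : nat :=
  #|[set S : {set G} | graph_iso (induced S) H]|.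

Section Hypercube.
Variable p : nat.

Definition hypercube_adj : rel (p.-tuple bool) :=
  fun x y => #|[set i : 'I_p | tnth x i != tnth y i]| == 1.

Lemma hypercube_sym : symmetric hypercube_adj.
Proof.
by move=> x y; congr (_ == _); apply: eq_card => i; rewrite !inE eq_sym.
Qed.

Lemma hypercube_irr : irreflexive hypercube_adj.
Proof.
by move=> x; rewrite /hypercube_adj eq_card0 // => i; rewrite inE eqxx.
Qed.

Definition hypercube : sgraph := SGraph hypercube_sym hypercube_irr.
End Hypercube.

Section Munarini.
Variables n k : nat.

Definition word : finType := n.-tuple 'I_k.+1.

(* Positions a, a + 1, ..., b (inclusive) form a maximal run of the letter k. *)
Definition max_run (w : word) (a b : 'I_n) : bool :=
  [&& a <= b,
      [forall i : 'I_n, (a <= i <= b) ==> (tnth w i == k :> nat)],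
      [forall i : 'I_n, (i.+1 == a) ==> (tnth w i != k :> nat)]
    & [forall i : 'I_n, (i == b.+1 :> nat) ==> (tnth w i != k :> nat)]].

Definition pell (w : word) : bool :=
  [forall a : 'I_n, forall b : 'I_n, max_run w a b ==> ~~ odd (b - a).+1].

Definition pell_string : finType := {w : word | pell w}.

(* v arises from u by replacing one 0 with some letter in {1, ..., k - 1}. *)
Definition replace_0 (u v : word) : bool :=
  [exists i : 'I_n,
    [&& tnth u i == 0 :> nat, 1 <= tnth v i < k
      & [forall l : 'I_n, (l != i) ==> (tnth v l == tnth u l)]]].

(* v arises from u by replacing one factor 00 with kk. *)
Definition replace_00 (u v : word) : bool :=
  [exists i : 'I_n, exists j : 'I_n,
    [&& j == i.+1 :> nat,
        tnth u i == 0 :> nat, tnth u j == 0 :> nat,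
        tnth v i == k :> nat, tnth v j == k :> nat
      & [forall l : 'I_n, (l != i) && (l != j) ==> (tnth v l == tnth u l)]]].

Definition replace (u v : word) : bool := replace_0 u v || replace_00 u v.

(* The condition u != v only matters in the degenerate case k = 0. *)
Definition munarini_adj : rel pell_string :=
  fun u v => (u != v) && (replace (val u) (val v) || replace (val v) (val u)).

Lemma munarini_sym : symmetric munarini_adj.
Proof. by move=> u v; rewrite /munarini_adj eq_sym orbC. Qed.

Lemma munarini_irr : irreflexive munarini_adj.
Proof. by move=> u; rewrite /munarini_adj eqxx. Qed.

Definition munarini : sgraph := SGraph munarini_sym munarini_irr.
End Munarini.

(* Main.v *)
(** Parse a Pell string from the left into letters and factors kk, and encode
    it by the set of its nonzero blocks, each recorded as (position, letter).
    This encoding is injective, its image is closed under taking subsets, and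
    two strings are adjacent iff their sets differ in exactly one element.  In
    any such graph an embedded hypercube is an interval [[S \ T, S]] of sets:
    opposite edges of a 4-cycle flip the same element.  So the induced [Q_p]
    are counted by the pairs of a string with [d] nonzero blocks and a choice of
    [p] of these blocks, and the strings with [d] nonzero blocks are counted by
    a Pell-type recurrence in [n]. *)
Require Import Defs.
From HB Require Import structures.
From mathcomp Require Import all_boot zify.

Set Implicit Arguments.
Unset Strict Implicit.
Unset Printing Implicit Defensive.

(** * Hypercubes in graphs of sets *)

Section SymmetricDifference.
Variable B : finType.
Implicit Types (A C D : {set B}) (b c : B).

Definition symdiff A C : {set B} := [set b | (b \in A) (+) (b \in C)].

Lemma in_symdiff A C b : (b \in symdiff A C) = (b \in A) (+) (b \in C).
Proof. by rewrite inE. Qed.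

Lemma symdiffC A C : symdiff A C = symdiff C A.
Proof. by apply/setP => b; rewrite !in_symdiff addbC. Qed.

Lemma symdiffKl A C : symdiff A (symdiff A C) = C.
Proof. by apply/setP => b; rewrite !in_symdiff addbA addbb. Qed.

Lemma symdiff1P A C :
  reflect (exists b, C = symdiff A [set b]) (#|symdiff A C| == 1).
Proof.
apply: (iffP cards1P) => -[b E]; exists b; last by rewrite E symdiffKl.
by rewrite -E symdiffKl.
Qed.

Lemma symdiff1_cases A C : #|symdiff A C| == 1 ->
  (exists2 b, b \in A & C = A :\ b) \/ (exists2 b, b \in C & A = C :\ b).
Proof.
case/symdiff1P=> b ->; have [bA|bA] := boolP (b \in A); [left|right]; exists b => //.
- apply/setP => c; rewrite in_symdiff !inE; have [->|_] := eqVneq c b => /=.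
    by rewrite bA.
  by rewrite addbF.
- by rewrite in_symdiff (negPf bA) inE eqxx.
- apply/setP => c; rewrite !inE; have [->|_] := eqVneq c b => /=.
    exact: negPf.
  by rewrite addbF.
Qed.

Lemma card_symdiffD1 A b : b \in A -> #|symdiff A (A :\ b)| == 1.
Proof.
move=> bA; apply/cards1P; exists b; apply/setP => c; rewrite !inE.
by have [->|_] := eqVneq c b; rewrite ?bA //= addbb.
Qed.

End SymmetricDifference.

(* Opposite edges of a 4-cycle of sets flip the same element, so the element
   flipped along a direction of the cube does not depend on the base point. *)
Lemma cube_embedding (I B : finType) (h : {set I} -> {set B}) :
    injective h ->
    (forall (U : {set I}) i, i \notin U -> #|symdiff (h U) (h (i |: U))| == 1) ->
  exists2 f : I -> B, injective f & forall U : {set I}, h U = symdiff (h set0) (f @: U).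
Proof.
move=> hI hE.
(* [f i] is the element flipped along direction [i] at the base corner [set0]. *)
have /fin_all_exists[f fE] i : exists b, h [set i] = symdiff (h set0) [set b].
  by apply/symdiff1P; rewrite -[[set i]]setU0 hE ?inE.
have fI : injective f.
  move=> i j fij; have : h [set i] = h [set j] by rewrite !fE fij.
  by move/hI/set1_inj.
exists f => // U.
have [m] := ubnP #|U|; elim: m U => // m IH U; rewrite ltnS => leUm.
have [->|[i iU]] := set_0Vmem U.
  by rewrite imset0; apply/setP => b; rewrite in_symdiff inE addbF.
have [Ui0|[j]] := set_0Vmem (U :\ i).
  have -> : U = [set i] by rewrite -(setD1K iU) Ui0 setU0.
  by rewrite imset_set1 fE.
rewrite !inE => /andP[ji jU].
(* The sets [W], [U :\ i], [U :\ j] and [U] span a 4-cycle. Induction gives [h] at the first three,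
   and it remains to see that the edge from [U :\ i] to [U] flips [f i]. *)
set W := U :\ i :\ j.
have Ui : U :\ i = j |: W by rewrite setD1K // !inE ji.
have Uj : U :\ j = i |: W.
  have -> : W = U :\ j :\ i by rewrite /W !setDDl setUC.
  by rewrite setD1K // !inE eq_sym ji.
have cUi : #|U :\ i| < m by move: leUm; rewrite (cardsD1 i U) iU.
have cUj : #|U :\ j| < m by move: leUm; rewrite (cardsD1 j U) jU.
have cW : #|W| < m.
  by apply: leq_ltn_trans cUi; apply: subset_leq_card; rewrite Ui subsetUr.
have /symdiff1P[c hc] : #|symdiff (h (U :\ i)) (h U)| == 1.
  by rewrite -{2}(setD1K iU) hE // !inE eqxx.
have /symdiff1P[c' hc'] : #|symdiff (h (U :\ j)) (h U)| == 1.
  by rewrite -{2}(setD1K jU) hE // !inE eqxx.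
have hW := IH _ cW; have hUi := IH _ cUi; have hUj := IH _ cUj.
have inf (X : {set I}) l : (f l \in f @: X) = (l \in X) by rewrite mem_imset.
have nUW : h U != h W.
  by apply/eqP => /hI eUW; have := iU; rewrite eUW /W !inE eqxx andbF.
(* Flipping [f j] again would lead from [h (U :\ i)] back to [h W], against injectivity. *)
have ci : c != f j.
  apply: contraNneq nUW => cj; rewrite hc hUi hW cj Ui imsetU imset_set1.
  apply/eqP/setP => b; rewrite !inE; have [->|_] := eqVneq b (f j) => /=.
    by rewrite inf /W !inE eqxx /= !addbF addbK.
  by rewrite addbF.
have fji : f j != f i by apply: contraNneq ji => /fI ->.
have cE : c = f i.
  (* Both paths through the 4-cycle compute [h U]. Membership of [f j] forces [c' = f j], and then
     membership of [f i] forces [c = f i]. *)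
  have := hc; rewrite {1}hc' hUi hUj => /setP e.
  have := e (f i); have := e (f j).
  rewrite !in_symdiff !inf !inE !eqxx (eq_sym i j) (negPf ji) iU jU /=.
  rewrite (eq_sym (f j) c) (negPf ci) /= (eq_sym (f i) c).
  have [<-|nc'] := eqVneq (f j) c'; last by case: (f j \in h set0).
  rewrite (eq_sym (f i)) (negPf fji) => _.
  by case: (eqVneq c (f i)) => // _; case: (f i \in h set0).
rewrite hc hUi cE -{2}(setD1K iU) imsetU imset_set1.
apply/setP => b; rewrite !inE; have [->|_] := eqVneq b (f i) => /=.
  by rewrite inf !inE eqxx addbF.
by rewrite addbF.
Qed.

(** * Induced hypercubes in the graph of a down-closed family of sets *)

Section SimplexGraph.
Variables (G : sgraph) (B : finType) (phi : G -> {set B}).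
Hypothesis phi_inj : injective phi.
Hypothesis phi_D1 : forall x b, b \in phi x -> exists y, phi y = phi x :\ b.
Hypothesis phi_adj : forall x y, adj x y = (#|symdiff (phi x) (phi y)| == 1).

Lemma phi_down x (U : {set B}) : U \subset phi x -> exists y, phi y = U.
Proof.
have [m] := ubnP #|phi x|; elim: m x => // m IH x; rewrite ltnS => le_xm sUx.
have [eUx|] := eqVneq (phi x) U; first by exists x.
rewrite eqEsubset sUx andbT => /subsetPn[b bx bU].
have [y yE] := phi_D1 bx; apply: (IH y).
  by move: le_xm; rewrite yE (cardsD1 b (phi x)) bx.
by rewrite yE subsetD1 sUx.
Qed.

Definition interval (x : G) (T : {set B}) : {set G} :=
  [set y | (phi x :\: T \subset phi y) && (phi y \subset phi x)].

Lemma interval_top x T : x \in interval x T.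
Proof. by rewrite inE subsetDl subxx. Qed.

(** The vertex [x] is recovered as the top of the interval, and [T] from its bottom: down-closure
    provides a vertex with set [phi x :\: T]. *)
Lemma interval_inj x x' (T T' : {set B}) :
    T \subset phi x -> T' \subset phi x' ->
  interval x T = interval x' T' -> (x, T) = (x', T').
Proof.
move=> sT sT' e.
have exx' : x = x'.
  apply: phi_inj; apply/eqP; rewrite eqEsubset.
  have := interval_top x T; rewrite e inE => /andP[_ ->].
  by have := interval_top x' T'; rewrite -e inE => /andP[_ ->].
case: _ / exx' in sT' e *; congr (_, _).
have sub V V' : interval x V = interval x V' -> V \subset phi x -> V \subset V'.
  move=> eV sV; have [y yE] : exists y, phi y = phi x :\: V.
    exact/phi_down/subsetDl.
  have : y \in interval x V' by rewrite -eV inE yE subxx subsetDl.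
  rewrite inE yE => /andP[/subsetP sVV' _]; apply/subsetP => b bV.
  apply: contraLR bV => bV'; apply/negP => bV.
  by have := sVV' b; rewrite !inE bV' bV (subsetP sV) // => /(_ isT).
by apply/eqP; rewrite eqEsubset (sub _ _ e) // (sub _ _ (esym e)).
Qed.

(** An enumeration of [T] gives the coordinates: a vertex goes to its membership bits on [T], since
    off [T] its set agrees with [phi x]. *)
Lemma interval_hypercube p x (T : {set B}) :
  T \subset phi x -> #|T| = p -> graph_iso (induced (interval x T)) (hypercube p).
Proof.
move=> sT cT; pose e (i : 'I_p) : B := enum_val (cast_ord (esym cT) i).
have eI : injective e by move=> i j /enum_val_inj/cast_ord_inj.
have eT i : e i \in T by apply: enum_valP.
have Te b : b \in T -> exists i, b = e i.
  move=> bT; exists (cast_ord cT (enum_rank_in bT b)).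
  by rewrite /e cast_ordK enum_rankK_in.
pose f : {ffun induced (interval x T) -> hypercube p} :=
  [ffun y => [tuple e i \in phi (val y) | i < p]].
have phiE (y : induced (interval x T)) b :
    b \in phi (val y) = if b \in T then b \in phi (val y) else b \in phi x.
  have := valP y; rewrite inE => /andP[/subsetP s1 /subsetP s2].
  have [//|bT] := boolP (b \in T); apply/idP/idP; first exact: s2.
  by move=> bx; apply: s1; rewrite inE bT.
apply/existsP; exists f; apply/and3P; split.
- apply/injectiveP => y z; rewrite !ffunE => fyz.
  apply/val_inj/phi_inj/setP => b; rewrite phiE [RHS]phiE.
  have [/Te[i ->]|//] := boolP (b \in T).
  by have := congr1 (fun t => tnth t i) fyz; rewrite !tnth_mktuple.
- apply/forallP => t.
  have [y yE] : exists y, phi y = (phi x :\: T) :|: [set e i | i in tnth t].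
    apply: (@phi_down x); rewrite subUset subsetDl; apply/subsetP => b /imsetP[i _ ->].
    exact: (subsetP sT).
  have yI : y \in interval x T.
    rewrite inE yE subsetUl subUset subsetDl /=.
    by apply/subsetP => b /imsetP[i _ ->]; apply: (subsetP sT).
  apply/codomP; exists (exist _ y yI); rewrite ffunE; apply: eq_from_tnth => i.
  by rewrite tnth_mktuple /= yE !inE eT mem_imset.
- apply/forallP => y; apply/forallP => z; apply/eqP.
  rewrite !ffunE /= /induced_adj phi_adj /hypercube_adj.
  rewrite -(card_imset _ eI); congr (_ == 1); apply: eq_card => b.
  apply/imsetP/idP => [[i + ->]|].
    by rewrite inE !tnth_mktuple in_symdiff; case: (e i \in _); case: (e i \in _).
  rewrite in_symdiff phiE (phiE z); have [/Te[i ->]|_] := boolP (b \in T).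
    move=> ne; exists i => //; rewrite inE !tnth_mktuple; move: ne.
    by case: (e i \in _); case: (e i \in _).
  by rewrite addbb.
Qed.

Lemma hypercube_interval p (S : {set G}) :
    graph_iso (induced S) (hypercube p) ->
  exists x, exists2 T : {set B}, (T \subset phi x) && (#|T| == p) & S = interval x T.
Proof.
case/graph_isoP=> f [g fK gK] fE.
pose t (U : {set 'I_p}) : hypercube p := [tuple i \in U | i < p].
have tI : injective t.
  move=> U V e; apply/setP => i.
  by have := congr1 (fun t => tnth t i) e; rewrite !tnth_mktuple.
(* Cube vertices are read as sets of directions, so that [cube_embedding] applies. *)
pose h (U : {set 'I_p}) := phi (val (g (t U))).
have hI : injective h by move=> U V /phi_inj/val_inj/(can_inj gK)/tI.
have [|b bI hE] := cube_embedding hI.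
  move=> U i iU; rewrite /h -phi_adj -[adj _ _]/(adj (g (t U)) (g (t (i |: U)))) -fE !gK.
  apply/cards1P; exists i; apply/setP => j; rewrite !inE !tnth_mktuple !inE.
  by have [->|_] := eqVneq j i; rewrite ?(negPf iU) //= eqxx.
pose T := b @: [set: 'I_p].
have inb (U : {set 'I_p}) i : (b i \in b @: U) = (i \in U) by rewrite mem_imset.
have hT U c : c \notin T -> (c \in h U) = (c \in h set0).
  move=> cT; rewrite hE in_symdiff; case: imsetP => [[i _ cb]|_]; last exact: addbF.
  by rewrite cb imset_f in cT.
(* The top of the interval: from the base corner, flip exactly the elements of [T] that are still
   missing. *)
pose x := val (g (t [set i | b i \notin h set0])).
have xE : phi x = h set0 :|: T.
  apply/setP => c; rewrite -/(h _) in_setU; have [|cT] := boolP (c \in T).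
    case/imsetP=> i _ ->; rewrite orbT hE in_symdiff inb inE.
    by case: (b i \in h set0).
  by rewrite hT // orbF.
exists x; exists T.
  by rewrite xE subsetUr card_imset // cardsT card_ord eqxx.
apply/setP => y; rewrite inE xE setDUl setDv setU0; apply/idP/idP => [yS|].
  pose U : {set 'I_p} := [set i | tnth (f (exist _ y yS)) i].
  have -> : phi y = h U.
    rewrite /h; have -> : t U = f (exist _ y yS); last by rewrite fK.
    by apply: eq_from_tnth => i; rewrite tnth_mktuple inE.
  apply/andP; split; apply/subsetP => c; rewrite !inE.
    by case/andP=> cT; rewrite hT.
  by have [_|cT] := boolP (c \in T); rewrite ?orbT // hT // orbF.
case/andP=> /subsetP s1 /subsetP s2.
(* These are the directions in which [y] differs from the base corner. *)
pose U := [set i | (b i \in phi y) (+) (b i \in h set0)].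
suff /phi_inj -> : phi y = h U by apply: valP.
apply/setP => c; have [|cT] := boolP (c \in T).
  case/imsetP=> i _ ->; rewrite hE in_symdiff inb inE.
  by case: (b i \in h set0); case: (b i \in phi y).
rewrite hT //; apply/idP/idP => [/s2|c0].
  by rewrite inE (negPf cT) orbF.
by apply: s1; rewrite inE cT.
Qed.

Lemma num_induced_hypercube p :
  num_induced G (hypercube p) = \sum_x 'C(#|phi x|, p).
Proof.
pose P := [set z : G * {set B} | (z.2 \subset phi z.1) && (#|z.2| == p)].
(* The map from [(x, T)] to [interval x T] is a bijection from [P] onto the induced cubes. *)
have -> : num_induced G (hypercube p) = #|P|.
  rewrite /num_induced -(card_in_imset (f := fun z => interval z.1 z.2) (D := mem P)).
    apply: eq_card => S; rewrite inE; apply/idP/imsetP.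
      by case/hypercube_interval=> x [T PT ->]; exists (x, T); rewrite ?inE.
    case=> -[x T]; rewrite inE => /andP[/= sT /eqP cT] ->.
    exact: interval_hypercube.
  case=> x T [x' T']; rewrite !inE => /andP[/= sT _] /andP[/= sT' _].
  exact: interval_inj.
rewrite -sum1_card.
transitivity (\sum_(z : G * {set B} | (z.2 \subset phi z.1) && (#|z.2| == p)) 1).
  by apply: eq_bigl => z; rewrite inE.
rewrite -(pair_big_dep xpredT (fun x (T : {set B}) => (T \subset phi x) && (#|T| == p))
   (fun _ _ => 1)) /=.
apply: eq_bigr => x _; rewrite -cards_draws -sum1_card.
by apply: eq_bigl => T; rewrite inE.
Qed.

End SimplexGraph.
(** * Parsing words and counting them by weight *)

Section Words.
Variable k : nat.
Implicit Types (s : seq 'I_k.+1) (b : bool).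

(* [mid b s i] says that position [i] of [s] is the second half of a factor kk
   when [s] is parsed from the left; [b] is the answer for position 0. *)
Fixpoint mid b s i : bool :=
  if i is j.+1 then (nth ord0 s j == k :> nat) && ~~ mid b s j else b.

Lemma mid_cons b a s i : mid b (a :: s) i.+1 = mid ((a == k :> nat) && ~~ b) s i.
Proof. by elim: i => // i IH; rewrite [LHS]/= -/(mid b (a :: s) i.+1) IH. Qed.

(** A two-state automaton: [b] means that a factor kk has been opened and awaits its second
    letter. *)
Fixpoint parses b s : bool :=
  if s is a :: s' then (b ==> (a == k :> nat)) && parses ((a == k :> nat) && ~~ b) s'
  else ~~ b.

(** The number of nonzero blocks. Each is counted at its first letter, so a factor kk counts
    once. *)
Fixpoint weight b s : nat :=
  if s is a :: s' then ((a != 0 :> nat) && ~~ b) + weight ((a == k :> nat) && ~~ b) s'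
  else 0.

Lemma weight_size b s : weight b s <= size s.
Proof.
elim: s b => //= a s IH b; have := IH ((a == k :> nat) && ~~ b).
by case: (_ && _); case: (_ && _); lia.
Qed.

Lemma weightE b s :
  weight b s = \sum_(i < size s) ((nth ord0 s i != 0 :> nat) && ~~ mid b s i).
Proof.
elim: s b => [|a s IH] b; first by rewrite big_ord0.
rewrite big_ord_recl [LHS]/= IH; congr (_ + _); apply: eq_bigr => i _.
by rewrite mid_cons.
Qed.

(** The index is unbounded on purpose: past the end [nth] returns 0, which differs from [k], so the
    condition at [size s] says that no factor kk is left open. *)
Lemma parsesP b s : 0 < k ->
  reflect (forall i, mid b s i -> nth ord0 s i = k :> nat) (parses b s).
Proof.
move=> k0; elim: s b => [|a s IH] b /=.
  apply: (iffP idP) => [nb i|H].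
    elim: i => [|i _] /=; first by rewrite (negPf nb).
    by rewrite nth_nil /= eq_sym; case: eqP => // e; rewrite e in k0.
  by apply/negP => /(H 0) /= e; rewrite -e in k0.
apply: (iffP andP) => [[/implyP ba /IH H] [/ba/eqP //|i]|H].
  by rewrite mid_cons => /H.
split; first by apply/implyP => /(H 0)/eqP.
by apply/IH => i; rewrite -mid_cons => /H.
Qed.

End Words.

Lemma sum_tuple_cons (T : finType) n (F : seq T -> nat) :
  \sum_(t : n.+1.-tuple T) F t = \sum_a \sum_(t : n.-tuple T) F (a :: t).
Proof.
rewrite pair_big /=.
rewrite (reindex (fun z : T * n.-tuple T => [tuple of z.1 :: z.2])) //=.
exists (fun t : n.+1.-tuple T => (thead t, [tuple of behead t])) => [[a t] _|t _] /=.
  by congr (_, _); apply: val_inj.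
by rewrite [RHS]tuple_eta; apply: val_inj.
Qed.

(** With [j] factors kk a word of length [n] has [n - j] blocks. Choose the [d] nonzero ones, the
    [j] of them that are kk, and one of [m] letters for each of the others. *)
Definition pell_number m n d :=
  \sum_(0 <= j < d.+1) 'C(d, j) * 'C(n - j, d) * m ^ (d - j).

Lemma pell_number0 m n : pell_number m n 0 = 1.
Proof. by rewrite /pell_number big_nat1 !bin0. Qed.

Lemma pell_number0S m d : pell_number m 0 d.+1 = 0.
Proof. by rewrite /pell_number big1 // => j _; rewrite sub0n bin0n muln0. Qed.

Lemma pell_number1S m d : pell_number m 1 d.+1 = (d == 0) * m.
Proof.
rewrite /pell_number big_nat_recl // big1 => [|j _].
  by case: d => [|d]; rewrite bin0 !subn0 addn0 !mul1n ?expn1 ?bin_small.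
by rewrite subSS sub0n bin0n muln0.
Qed.

(** Pascal's rule is applied twice, first to ['C(n.+2 - j, d.+1)] and then to ['C(d.+1, j)]. *)
Lemma pell_numberSS m n d :
  pell_number m n.+2 d.+1 =
    pell_number m n d + m * pell_number m n.+1 d + pell_number m n.+1 d.+1.
Proof.
rewrite /pell_number.
have -> : \sum_(0 <= j < d.+2) 'C(d.+1, j) * 'C(n.+2 - j, d.+1) * m ^ (d.+1 - j) =
  \sum_(0 <= j < d.+2) 'C(d.+1, j) * 'C(n.+1 - j, d) * m ^ (d.+1 - j) +
  \sum_(0 <= j < d.+2) 'C(d.+1, j) * 'C(n.+1 - j, d.+1) * m ^ (d.+1 - j).
  rewrite -big_split /= big_nat [RHS]big_nat; apply: eq_bigr => j /andP[_ jd].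
  rewrite -mulnDl -mulnDr; congr (_ * _ * _).
  have [jn|nj] := leqP j n.+1; first by rewrite subSn // binS addnC.
  by rewrite !bin_small //; lia.
congr (_ + _).
rewrite big_nat_recl // bin0 !subn0 mul1n.
under eq_bigr => j _ do rewrite !subSS binS !mulnDl.
rewrite big_split /= addnA addnC; congr (_ + _).
rewrite [in RHS]big_nat_recl // [X in _ + X]big_nat_recr //= (@bin_small d d.+1) // !mul0n addn0.
rewrite mulnDr bin0 mul1n !subn0 expnS mulnCA; congr (_ + _).
rewrite big_distrr /= big_nat [RHS]big_nat; apply: eq_bigr => j /andP[_ jd].
by rewrite subSS -(subnSK jd) expnS mulnCA.
Qed.

(** * Counting parsable words by weight *)

Section Counting.
Variable k : nat.
Hypothesis k_gt0 : 0 < k.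

Definition parse_count b n d :=
  \sum_(t : n.-tuple 'I_k.+1) (parses b t && (weight b t == d)).

Lemma parse_count0 b d : parse_count b 0 d = ~~ b && (d == 0).
Proof.
rewrite /parse_count (big_pred1 [tuple]) /= ?(eq_sym d) // => t.
by rewrite (tuple0 t) /= eqxx.
Qed.

Lemma parse_count_mid n d : parse_count true n.+1 d = parse_count false n d.
Proof.
rewrite /parse_count (sum_tuple_cons _ (fun s => parses true s && (weight true s == d) : nat)).
rewrite big_ord_recr /= big1 ?add0n => [|a _].
  by apply: eq_bigr => t _; rewrite !eqxx /= andbF.
by rewrite big1 // => t _; rewrite (ltn_eqF (ltn_ord a)).
Qed.

(** Split on the first letter: 0 adds no weight, each of the [k - 1] middle letters is a block by
    itself, and [k] opens a factor kk. *)
Lemma parse_countS n d :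
  parse_count false n.+1 d = parse_count false n d +
    (if d is d'.+1 then (k - 1) * parse_count false n d' + parse_count true n d' else 0).
Proof.
rewrite /parse_count (sum_tuple_cons _ (fun s => parses false s && (weight false s == d) : nat)).
case: k k_gt0 => // m _; rewrite big_ord_recl big_ord_recr /= subn1 /=.
congr (_ + _).
case: d => [|d].
  rewrite !big1 // => [t _|a _]; first by rewrite andbF.
  by rewrite big1 // => t _; rewrite andbF.
congr (_ + _).
  under eq_bigr => a _.
    rewrite /bump /= add1n eqSS (ltn_eqF (ltn_ord a)) /=.
    under eq_bigr => t _ do rewrite add1n eqSS.
    over.
  by rewrite sum_nat_const card_ord.
by apply: eq_bigr => t _; rewrite /bump /= !add1n eqSS eqxx.
Qed.

Lemma parse_countE n d : parse_count false n d = pell_number (k - 1) n d.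
Proof.
have [N] := ubnP n; elim: N n d => // N IH [|[|n]] d; rewrite ltnS => nN.
- by rewrite parse_count0; case: d => [|d]; rewrite ?pell_number0 ?pell_number0S.
- rewrite parse_countS parse_count0; case: d => [|d]; first by rewrite pell_number0.
  by rewrite !parse_count0 pell_number1S /= add0n addn0 mulnC.
- rewrite parse_countS; case: d => [|d]; first by rewrite IH // !pell_number0.
  by rewrite parse_count_mid !IH ?pell_numberSS; lia.
Qed.

End Counting.

(** * The Munarini graph as a graph of sets *)

Section Encoding.
Variables n k : nat.
Hypothesis k_gt0 : 0 < k.
Implicit Types (u v w : word n k) (i : nat).

(** Indexing by [nat] allows positions such as [i.+1] without bounds. The default 0 past the end is
    never [k], as [k] is positive. *)
Definition letter w i : 'I_k.+1 := nth ord0 w i.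

Lemma tnth_letter w (i : 'I_n) : tnth w i = letter w i.
Proof. exact: tnth_nth. Qed.

Lemma letter_overflow w i : n <= i -> letter w i = ord0.
Proof. by move=> ni; rewrite /letter nth_default // size_tuple. Qed.

Lemma letter_eqk_lt w i : letter w i = k :> nat -> i < n.
Proof.
by case: ltnP => // /letter_overflow -> /= k0; move: k_gt0; rewrite -k0.
Qed.

Lemma word_eq u v : letter u =1 letter v -> u = v.
Proof. by move=> e; apply: eq_from_tnth => i; rewrite !tnth_letter; apply: e. Qed.

(** Here [m] starts the possibly empty run of [k] that ends just before [i]. Parsing pairs off its
    letters, so [mid] is the parity of its length. *)
Lemma run_before w i : exists m,
  [/\ m <= i, forall j, m <= j < i -> letter w j = k :> nat,
      forall j, j.+1 = m -> letter w j <> k :> nat & mid false w i = odd (i - m)].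
Proof.
elim: i => [|i [m [mi run left midE]]]; first by exists 0; split=> // j; lia.
have [ik|ik] := eqVneq (letter w i : nat) k.
  exists m; split=> //; first lia.
    move=> j; rewrite ltnS [j <= i]leq_eqVlt => /andP[mj /orP[/eqP->//|ji]].
    by rewrite run ?mj.
  by rewrite /= -/(letter w i) ik eqxx midE subSn.
exists i.+1; split=> // [j|j [->]|]; [lia|exact/eqP|].
by rewrite /= subnn -/(letter w i) (negPf ik).
Qed.

(** A parse failing at [i] exhibits a maximal run of odd length ending just before [i]. Conversely
    [mid] alternates along a maximal run, so an odd length would demand one more [k] after its
    end. *)
Lemma pell_parses w : pell w = parses false w.
Proof.
apply/idP/parsesP => // [pw i mi|H].
  apply/eqP; apply: contraT => ik.
  have [m [le_mi run left]] := run_before w i; rewrite mi => /esym odd_im.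
  case: i => [|b] in mi ik le_mi run odd_im *; first by [].
  have lt_mb : m <= b by move: odd_im; case: ltngtP le_mi => // -> ; rewrite subnn.
  have bn : b < n by apply: (@letter_eqk_lt w); apply: run; lia.
  have mn : m < n by lia.
  move/forallP/(_ (Ordinal mn))/forallP/(_ (Ordinal bn))/implyP: pw.
  rewrite -subSn // odd_im => /(_ _)/negP []//; apply/and4P; split=> //.
  - by apply/forallP => j; apply/implyP => /= mjb; rewrite tnth_letter; apply/eqP/run.
  - by apply/forallP => j; apply/implyP => /= /eqP jm; rewrite tnth_letter; apply/eqP/left.
  - by apply/forallP => j; apply/implyP => /= /eqP jb; rewrite tnth_letter jb.
apply/forallP => a; apply/forallP => b; apply/implyP.
case/and4P=> ab /forallP run /forallP left /forallP right.
have runE j : a <= j <= b -> letter w j == k :> nat.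
  move=> ajb; have jn : j < n by have := ltn_ord b; lia.
  by have /implyP/(_ ajb) := run (Ordinal jn); rewrite tnth_letter.
have mida : mid false w a = false.
  have := left; case: (a : nat) (ltn_ord a) => // j jn {}left.
  have jn' : j < n by lia.
  by have /implyP/(_ (eqxx _)) := left (Ordinal jn'); rewrite tnth_letter /= => /negPf ->.
have midE t : a + t <= b.+1 -> mid false w (a + t) = odd t.
  elim: t => [|t IH] le; first by rewrite addn0.
  by rewrite addnS /= IH 1?[_ == _]runE //; lia.
apply/negP => odd_ab.
have /H bk : mid false w b.+1.
  by have := midE (b.+1 - a); rewrite subnKC ?(leqW ab) // => -> //; rewrite subSn.
have bn := letter_eqk_lt bk.
have /implyP/(_ (eqxx _)) := right (Ordinal bn).
by rewrite tnth_letter /= bk eqxx.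
Qed.

Lemma pellP w : reflect (forall i, mid false w i -> letter w i = k :> nat) (pell w).
Proof. by rewrite pell_parses; apply: parsesP. Qed.

Definition blocks w : {set 'I_n * 'I_k.+1} :=
  [set z : 'I_n * 'I_k.+1 | [&& letter w z.1 == z.2, z.2 != ord0 & ~~ mid false w z.1]].

Lemma card_blocks w : #|blocks w| = weight false w.
Proof.
rewrite weightE size_tuple.
pose D := [set i : 'I_n | (letter w i != ord0) && ~~ mid false w i].
have -> : blocks w = [set (i, letter w i) | i : 'I_n in D].
  apply/setP => -[i c]; rewrite inE /=; apply/and3P/imsetP => [[/eqP <- c0 m]|[j]].
    by exists i => //; rewrite inE c0.
  by rewrite inE => /andP[c0 m] [-> ->].
rewrite card_imset => [|i j []//]; rewrite -sum1_card big_mkcond /=.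
by apply: eq_bigr => i _; rewrite inE; case: (_ && _).
Qed.

Lemma blocks_inj u v : pell u -> pell v -> blocks u = blocks v -> u = v.
Proof.
move=> /pellP pu /pellP pv /setP e.
(* The words are rebuilt from left to right: the prefix determines [mid] at [i], and the letter
   there is [k] if [mid] holds, else the recorded letter, or 0 if none is recorded. *)
suff H i : mid false u i = mid false v i /\ (forall j, j < i -> letter u j = letter v j).
  by apply: word_eq => i; have [_] := H i.+1; apply.
elim: i => // i [mE lE].
have eE : letter u i = letter v i.
  have [mu|mu] := boolP (mid false u i).
    by apply: val_inj; rewrite /= pu // pv // -mE.
  have [ni|lt_in] := leqP n i; first by rewrite !letter_overflow.
  have := e (Ordinal lt_in, letter u i); have := e (Ordinal lt_in, letter v i).
  rewrite !inE /= -mE mu !eqxx !andbT /=.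
  have [//|_] := eqVneq (letter u i) (letter v i).
  by move=> /esym/negbFE/eqP -> /negbFE/eqP ->.
split; first by rewrite /= mE -/(letter u i) -/(letter v i) eE.
by move=> j; rewrite ltnS leq_eqVlt => /orP[/eqP ->|/lE].
Qed.

(** * Erasing a block, and adjacency as removal of one element *)

Definition in_block w i j : bool := (j == i) || ((letter w i == k :> nat) && (j == i.+1)).

Definition erase w i : word n k :=
  [tuple if in_block w i j then ord0 else letter w j | j < n].

Lemma letter_erase w i j : letter (erase w i) j = if in_block w i j then ord0 else letter w j.
Proof.
have [nj|jn] := leqP n j; first by rewrite !letter_overflow // if_same.
by rewrite -[j]/(val (Ordinal jn)) -tnth_letter tnth_mktuple.
Qed.

(** Since [i] starts a block, the parser is between blocks right after that block, erased or not.
    Only the flag inside a factor kk changes. *)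
Lemma mid_erase w i j : ~~ mid false w i ->
  mid false (erase w i) j = mid false w j && ~~ ((letter w i == k :> nat) && (j == i.+1)).
Proof.
move=> mi; elim: j => //= j IH.
rewrite -/(letter (erase w i) j) -/(letter w j) letter_erase IH eqSS /in_block.
have k0 : (0 == k) = false by rewrite eq_sym; apply/negbTE; rewrite -lt0n.
have [->|ji] := eqVneq j i => /=.
  by rewrite k0 mi !andbT; case: (_ == _).
have [ik|_] /= := eqVneq (letter w i : nat) k; last by rewrite !andbT.
have [->|_] /= := eqVneq j i.+1; last by rewrite !andbT.
by rewrite k0 -/(letter w i) ik eqxx mi /= andbF.
Qed.

Lemma pell_erase w i : pell w -> ~~ mid false w i -> pell (erase w i).
Proof.
move=> /pellP pw mi; apply/pellP => j; rewrite mid_erase // letter_erase => /andP[mj].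
rewrite /in_block => /negPf ->; have [ji|_] := eqVneq j i; last exact: pw.
by rewrite ji (negPf mi) in mj.
Qed.

Lemma blocks_erase w (i : 'I_n) : pell w -> ~~ mid false w i ->
  blocks (erase w i) = blocks w :\ (i, letter w i).
Proof.
move=> /pellP pw mi; apply/setP => -[j c]; rewrite !inE /= mid_erase // letter_erase xpair_eqE.
rewrite /in_block (_ : (j == i) = (j == i :> nat)) //=.
have [->|ji] /= := eqVneq (j : nat) i.
  rewrite (eq_sym ord0); case: (eqVneq c ord0) => [->|c0]; rewrite ?andbF //=.
  by rewrite (eq_sym c); case: (letter w i == c).
case: (boolP ((letter w i == k :> nat) && (j == i.+1 :> nat))) => [|_];
  last by rewrite andbT.
case/andP=> ik /eqP jE; rewrite (eq_sym ord0) andbF.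
by case: (c == ord0); rewrite /= ?andbF // jE /= -/(letter w i) ik mi andbF.
Qed.

Lemma replace_erase w (i : 'I_n) : pell w -> ~~ mid false w i ->
  letter w i != ord0 -> replace (erase w i) w.
Proof.
move=> /pellP pw mi wi0; rewrite /replace.
have [ik|ik] := eqVneq (letter w i : nat) k; last first.
  apply/orP; left; apply/existsP; exists i.
  rewrite !tnth_letter letter_erase /in_block eqxx /= lt0n wi0.
  rewrite ltn_neqAle ik -ltnS ltn_ord /=.
  apply/forallP => l; apply/implyP => li.
  by rewrite !tnth_letter letter_erase /in_block (negPf ik) (negPf (li : l != i :> nat)).
(* The Pell condition completes the factor kk opened at [i], which also puts [i.+1] within
   bounds. *)
have wk : letter w i.+1 = k :> nat by apply: pw; rewrite /= -/(letter w i) ik eqxx.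
apply/orP; right; apply/existsP; exists i; apply/existsP; exists (Ordinal (letter_eqk_lt wk)).
rewrite !tnth_letter !letter_erase /in_block /= ik wk !eqxx orbT /=.
apply/forallP => l; apply/implyP => /andP[li lj].
rewrite !tnth_letter letter_erase /in_block ik.
by rewrite (negPf (li : l != i :> nat)) (negPf (lj : l != i.+1 :> nat)) andbF.
Qed.

Lemma mid_prefix u v i : (forall j, j < i -> letter u j = letter v j) ->
  mid false u i = mid false v i.
Proof.
elim: i => //= i IH e; rewrite -/(letter u i) -/(letter v i) e // IH // => j ji.
by rewrite e // ltnW.
Qed.

(** Converse of [replace_erase]. The point is that the changed position starts a block of [u],
    rather than being the second half of a factor kk. *)
Lemma replaceP u v : pell u -> pell v -> replace v u ->
  exists i : 'I_n, [/\ ~~ mid false u i, letter u i != ord0 & v = erase u i].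
Proof.
move=> /pellP pu /pellP pv /orP[/existsP[i]|/existsP[i /existsP[j]]].
  rewrite !tnth_letter => /and3P[/eqP vi /andP[ui0 uik] /forallP e]; exists i.
  have uik' : (letter u i == k :> nat) = false by rewrite ltn_eqF.
  split; [|by rewrite -val_eqE /= -lt0n|].
    by apply/negP => /pu/eqP; rewrite uik'.
  apply: eq_from_tnth => l; rewrite tnth_mktuple /in_block uik' orbF.
  have [/val_inj ->|li] := eqVneq (l : nat) i.
    by apply: val_inj; rewrite tnth_letter.
  by have /implyP/(_ li)/eqP := e l; rewrite !tnth_letter => <-.
rewrite !tnth_letter => /and5P[/eqP jE /eqP vi /eqP vj /eqP ui /andP[/eqP uj /forallP e]].
have eE (l : 'I_n) : l != i -> l != j -> letter v l = letter u l.
  by move=> li lj; have := e l; rewrite li lj /= !tnth_letter => /eqP.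
exists i; split; last first.
- apply: eq_from_tnth => l; rewrite tnth_mktuple /in_block (_ : letter u i = k :> nat) // eqxx /=.
  have [/val_inj ->|li] := eqVneq (l : nat) i.
    by apply: val_inj; rewrite tnth_letter.
  have [lj|lj] := eqVneq (l : nat) i.+1.
    by apply: val_inj; rewrite tnth_letter lj -jE.
  by rewrite tnth_letter -/(letter v l) eE // -val_eqE /= jE.
- by rewrite -val_eqE /= ui -lt0n.
(* [v] and [u] agree before [i], so a misaligned kk would leave [v] unparsable. *)
rewrite (@mid_prefix u v); first
  by apply/negP => /pv; rewrite vi => k0; move: k_gt0; rewrite -k0.
move=> l li; have ln : l < n by have := ltn_ord i; lia.
by rewrite -[l]/(val (Ordinal ln)) eE // -val_eqE /=; lia.
Qed.

Lemma munarini_adjE (x y : munarini n k) :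
  adj x y = (#|symdiff (blocks (val x)) (blocks (val y))| == 1).
Proof.
have rD (u v : munarini n k) : replace (val v) (val u) ->
    exists2 z, z \in blocks (val u) & blocks (val v) = blocks (val u) :\ z.
  case/(replaceP (valP u) (valP v))=> i [mi ui ->].
  by exists (i, letter (val u) i); rewrite ?blocks_erase ?(valP u) // inE /= eqxx ui.
(* By [blocks_inj], a string whose set lacks exactly this block must be the erased one. *)
have Dr (u v : munarini n k) z : z \in blocks (val u) ->
    blocks (val v) = blocks (val u) :\ z -> replace (val v) (val u).
  case: z => i c; rewrite inE /= => /and3P[/eqP <- ui mi].
  rewrite -blocks_erase ?(valP u) // => /blocks_inj -> //; rewrite ?(valP v) //.
    by apply: replace_erase; rewrite ?(valP u).
  by apply: pell_erase; rewrite ?(valP u).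
rewrite /= /munarini_adj; apply/andP/idP => [[_ /orP[]/rD[z zx ->]]|].
- by rewrite symdiffC card_symdiffD1.
- by rewrite card_symdiffD1.
move=> c1; split.
  apply: contraTneq c1 => ->; rewrite (_ : symdiff _ _ = set0) ?cards0 //.
  by apply/setP => z; rewrite !inE addbb.
by case: (symdiff1_cases c1) => -[z zx /(Dr _ _ _ zx) ->]; rewrite ?orbT.
Qed.

End Encoding.

Theorem corollary4p6 (n k p : nat) (hk : 1 <= k) (hp : p <= n) :
  num_induced (munarini n k) (hypercube p) =
    \sum_(p <= d < n.+1) \sum_(0 <= j < d.+1)
      'C(d, p) * 'C(d, j) * 'C(n - j, d) * (k - 1) ^ (d - j).
Proof.
rewrite (@num_induced_hypercube _ _ (fun x : munarini n k => blocks (val x))); first last.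
- exact: munarini_adjE.
- move=> x [i c]; rewrite inE /= => /and3P[/eqP <- xi mi].
  exists (exist _ (erase (val x) i) (pell_erase hk (valP x) mi)).
  by rewrite /= blocks_erase // (valP x).
- by move=> x y /(blocks_inj hk (valP x) (valP y))/val_inj.
transitivity (\sum_(w : word n k | pell w) 'C(weight false w, p)).
  rewrite (reindex_omap (val : pell_string n k -> _) insub) => [|w pw]; last by rewrite insubT.
  by apply: eq_big => x; rewrite ?card_blocks // valK eqxx andbT (valP x).
transitivity (\sum_(0 <= d < n.+1) 'C(d, p) * pell_number (k - 1) n d).
  rewrite big_mkord.
  (* Words are grouped by weight, which is at most [n] by [weight_size], so [inord] loses
     nothing. *)
  rewrite (partition_big (fun w : word n k => inord (weight false w) : 'I_n.+1) xpredT) //=.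
  apply: eq_bigr => d _; rewrite -parse_countE // /parse_count big_distrr /=.
  rewrite big_mkcond /=; apply: eq_bigr => w _.
  have wn : weight false w < n.+1 by rewrite ltnS -{2}(size_tuple w) weight_size.
  rewrite -val_eqE /= inordK // pell_parses //.
  by have [->|_] := eqVneq (weight false w) d; case: (parses _ _); rewrite ?muln1 ?muln0.
(* The terms with [d < p] vanish because ['C(d, p)] is 0. *)
rewrite (big_cat_nat (n := p)) //=; last exact: leqW.
rewrite big_nat big1 ?add0n => [|d /andP[_ dp]]; last by rewrite bin_small.
apply: eq_bigr => d _; rewrite /pell_number big_distrr /=.
by apply: eq_bigr => j _; rewrite !mulnA.
Qed.
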